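(* Let $I\subset(0,\infty)$ be a closed bounded interval, let $J\subseteq\mathbb{R}$ with $[0,1]\subseteq J$, let $h:J\to\mathbb{R}$ be a nonnegative function, and let $f:I\to(0,\infty)$ be an $h$-multi convex function on $I$. Then for all $x,y\in I$ with $x\ne y$, $$\frac12\left[\frac{1}{\ln y-\ln x}\int_x^y\frac{f(\gamma)}{\gamma}\,d\gamma+\frac{1}{y-x}\int_x^y f(\gamma)\,d\gamma\right]\le \int_0^1 [f(x)]^{h(t)}[f(y)]^{h(1-t)}dt.$$
   Context: A positive function $f$ on an interval $I\subset(0,\infty)$ is called $h$-multi convex if for all $x,y\in I$ and all $t,\lambda\in[0,1]$, $\lambda f(x^t y^{1-t})+(1-\lambda)f(tx+(1-t)y)\le [f(x)]^{h(t)}[f(y)]^{h(1-t)}$, where $h:J\to\mathbb{R}$ is a nonnegative function on $J\subseteq\mathbb{R}$. *)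

(* Defs.v *)
From HB Require Import structures.
From mathcomp Require Import all_boot all_order all_algebra.
From mathcomp Require Import all_classical all_reals all_analysis.

Set Implicit Arguments.
Unset Strict Implicit.
Unset Printing Implicit Defensive.

Import Order.TTheory GRing.Theory Num.Theory.
Import numFieldNormedType.Exports.

Local Open Scope classical_set_scope.
Local Open Scope ring_scope.

(* [f] is meant to be positive on an interval [I] of positive reals, and [h] to
   be nonnegative on a set containing [[0, 1]]; values of [f] outside [I] and of
   [h] outside [[0, 1]] play no role. *)
Definition h_multi_convex (R : realType) (I : set R) (h f : R -> R) : Prop :=
  forall x y t l : R, I x -> I y -> 0 <= t <= 1 -> 0 <= l <= 1 ->
    l * f (x `^ t * y `^ (1 - t)) + (1 - l) * f (t * x + (1 - t) * y)
      <= f x `^ h t * f y `^ h (1 - t).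

(* The oriented integral from [x] to [y]: the limits may be in either order.
   It is extended-real valued, so no integrability is required. For a
   nonnegative function, [\int] is the supremum of the integrals of the simple
   functions below it, which is its Lebesgue integral as soon as the function is
   Lebesgue (not only Borel) measurable. *)
Definition oriented_integral (R : realType) (x y : R) (g : R -> R) : \bar R :=
  if x <= y then (\int[lebesgue_measure]_(u in `[x, y]) (g u)%:E)%E
  else (- \int[lebesgue_measure]_(u in `[y, x]) (g u)%:E)%E.

(* Main.v *)
Require Import Defs.
From HB Require Import structures.
From mathcomp Require Import all_boot all_order all_algebra.
From mathcomp Require Import all_classical all_reals all_analysis.
From mathcomp Require Import measurable_realfun.
From mathcomp Require Import ring lra.
Import Order.TTheory GRing.Theory Num.Theory.
Import numFieldNormedType.Exports.
Local Open Scope classical_set_scope.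
Local Open Scope ring_scope.

(* Substituting u = x^t y^(1-t), resp. u = t x + (1 - t) y, turns the two means
   of f into integrals over [0, 1], and the inequality is then the defining one
   with l = 1/2, integrated in t. Since f and h need not be measurable, all these
   integrals are lower integrals (suprema over simple functions below the
   integrand): they are still monotone, but addition and scaling survive only as
   inequalities, and the substitutions are performed on the simple functions,
   through the uniqueness of Lebesgue measure. *)

(** * Lower integrals of nonnegative functions, without measurability *)

Section lower_integral.
Local Open Scope ereal_scope.
Context d (T : measurableType d) (R : realType).
Variables (mu : {measure set T -> \bar R}) (D : set T).
Implicit Types (f g : T -> \bar R) (c : \bar R).

Import HBNNSimple.

(** This and the next lemma are the two halves of the supremum property: a least upper bound and an
    upper bound. Non-measurable integrands are handled through them, one simple function at a
    time. *)
Lemma ge0_integral_le_nnsfun f c : (forall x, D x -> 0 <= f x) ->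
  (forall s : {nnsfun T >-> R}, (forall x, (s x)%:E <= (f \_ D) x) ->
    \int[mu]_x (s x)%:E <= c) ->
  \int[mu]_(x in D) f x <= c.
Proof.
move=> f0 sc; rewrite ge0_integralE//.
by apply: ge_ereal_sup => _ [s /= sf <-]; rewrite -integralT_nnsfun; exact: sc.
Qed.

Lemma nnsfun_le_ge0_integral (s : {nnsfun T >-> R}) f :
    (forall x, D x -> 0 <= f x) -> (forall x, (s x)%:E <= (f \_ D) x) ->
  \int[mu]_x (s x)%:E <= \int[mu]_(x in D) f x.
Proof.
move=> f0 sf; rewrite [leRHS]ge0_integralE// integralT_nnsfun.
by apply: ereal_sup_ubound; exists s.
Qed.

Lemma ge0_le_lower_integral f g : (forall x, D x -> 0 <= f x) ->
  (forall x, D x -> f x <= g x) ->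
  \int[mu]_(x in D) f x <= \int[mu]_(x in D) g x.
Proof.
move=> f0 fg; apply: ge0_integral_le_nnsfun => // s sf.
apply: nnsfun_le_ge0_integral => [x Dx|x].
  by rewrite (le_trans (f0 x Dx))// fg.
rewrite (le_trans (sf x))// /patch; case: ifPn => // /[!inE] Dx; exact: fg.
Qed.

(** If [s] and [t] are simple functions below [f] and [g], then [s + t] is one below [f + g], and
    additivity is exact for simple functions. The suprema over [s] and over [t] are then taken one
    after the other. *)
Lemma le_lower_integralD f g :
    (forall x, D x -> 0 <= f x) -> (forall x, D x -> 0 <= g x) ->
  \int[mu]_(x in D) f x + \int[mu]_(x in D) g x
    <= \int[mu]_(x in D) (f x + g x).
Proof.
move=> f0 g0; set c := \int[mu]_(x in D) (f x + g x).
have st (s t : {nnsfun T >-> R}) : (forall x, (s x)%:E <= (f \_ D) x) ->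
    (forall x, (t x)%:E <= (g \_ D) x) ->
    \int[mu]_x (s x)%:E + \int[mu]_x (t x)%:E <= c.
  move=> sf tg; rewrite -ge0_integralD//; last 4 first.
  - by move=> x _; rewrite lee_fin.
  - exact/measurable_EFinP/measurable_funP.
  - by move=> x _; rewrite lee_fin.
  - exact/measurable_EFinP/measurable_funP.
  apply: (@nnsfun_le_ge0_integral (add_nnsfun s t)) => x.
    by move=> Dx; rewrite adde_ge0// ?f0// g0.
  move: (sf x) (tg x); rewrite /patch; case: ifPn => _ sfx tgx.
    by rewrite EFinD leeD.
  by rewrite EFinD -[leRHS]adde0 leeD.
have c0 : 0 <= c by apply: integral_ge0 => x Dx; rewrite adde_ge0 ?f0 ?g0.
(* Once [c] is finite, every summand bounded by it is finite too, so it can be moved across an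
   inequality by subtraction. *)
have [->|cfin] := eqVneq c +oo; first by rewrite leey.
have {cfin}cfin : c \is a fin_num by rewrite ge0_fin_numE// ltey.
have fin (b b' : \bar R) : 0 <= b -> 0 <= b' -> b' + b <= c -> b \is a fin_num.
  move=> b0 b'0 bc; rewrite ge0_fin_numE//; apply: le_lt_trans (_ : c < +oo).
    by rewrite (le_trans _ bc)// leeDr.
  by rewrite ltey_eq cfin.
have s0 (s : {nnsfun T >-> R}) : 0 <= \int[mu]_x (s x)%:E.
  by apply: integral_ge0 => x _; rewrite lee_fin.
(* Supremum over [s] with [t] fixed. Pairing [t] with the zero simple function shows that its
   integral is finite. *)
have fc (t : {nnsfun T >-> R}) : (forall x, (t x)%:E <= (g \_ D) x) ->
    \int[mu]_(x in D) f x + \int[mu]_x (t x)%:E <= c.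
  move=> tg.
  have nn0 x : ((@nnsfun0 _ T R) x)%:E <= (f \_ D) x.
    by rewrite /patch; case: ifPn => // /[!inE] /f0.
  have tfin : \int[mu]_x (t x)%:E \is a fin_num.
    exact: (fin _ _ (s0 t) (s0 nnsfun0) (st nnsfun0 t nn0 tg)).
  rewrite -leeBrDr//; apply: ge0_integral_le_nnsfun => // s sf.
  by rewrite leeBrDr//; exact: st.
have nn0 x : ((@nnsfun0 _ T R) x)%:E <= (g \_ D) x.
  by rewrite /patch; case: ifPn => // /[!inE] /g0.
have ffin : \int[mu]_(x in D) f x \is a fin_num.
  by have := fc _ nn0; rewrite addeC; apply: fin => //; exact: integral_ge0.
(* Supremum over [t], now that the integral of [f] is known to be finite. *)
rewrite -leeBrDl//; apply: ge0_integral_le_nnsfun => // t tg.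
by rewrite leeBrDl//; exact: fc.
Qed.

(** A simple function [s] below [k * f] gives the simple function [k^-1 * s] below [f]. *)
Lemma lower_integralZl_le (k : R) f : (0 < k)%R ->
    (forall x, D x -> 0 <= f x) ->
  \int[mu]_(x in D) (k%:E * f x) <= k%:E * \int[mu]_(x in D) f x.
Proof.
move=> k0 f0; apply: ge0_integral_le_nnsfun => [x Dx|s skf].
  by apply: mule_ge0; [rewrite lee_fin ltW|exact: f0].
rewrite -lee_pdivrMl// -ge0_integralZl_EFin//; last 3 first.
- by move=> x _; rewrite lee_fin.
- exact/measurable_EFinP/measurable_funP.
- by rewrite invr_ge0 ltW.
have kV0 : (0 <= k^-1)%R by rewrite invr_ge0 ltW.
apply: (@nnsfun_le_ge0_integral (scale_nnsfun s kV0)) => // x.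
rewrite /= EFinM lee_pdivrMl//.
by move: (skf x); rewrite /patch; case: ifPn => // _; rewrite mule0.
Qed.

End lower_integral.

(** * Change of variables when [nu] is the image under [psi] of the measure with density [w] with
    respect to [mu] *)

Section density_substitution.
Local Open Scope ereal_scope.
Context d1 d2 (X : measurableType d1) (Y : measurableType d2) (R : realType).
Variables (mu : {measure set X -> \bar R}) (nu : {measure set Y -> \bar R}).
Variables (psi : X -> Y) (w : X -> R).
Hypothesis mpsi : measurable_fun setT psi.
Hypothesis mw : measurable_fun setT w.
Hypothesis w0 : forall x, (0 <= w x)%R.
Hypothesis nuE : forall A, measurable A ->
  nu A = \int[mu]_(x in psi @^-1` A) (w x)%:E.

Import HBNNSimple.

Let integral_indic_density A : measurable A ->
  \int[mu]_x ((\1_A (psi x))%:E * (w x)%:E) = nu A.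
Proof.
move=> mA; rewrite nuE// [RHS]integral_mkcond; apply: eq_integral => x _.
rewrite /patch indicE.
have -> : (x \in psi @^-1` A) = (psi x \in A) by apply/idP/idP; rewrite !inE.
by case: (psi x \in A); rewrite ?mul1e// mul0e.
Qed.

Let measurable_indic_density (r : R) (A : set Y) : measurable A ->
  measurable_fun setT (fun x => (r * \1_A (psi x))%:E * (w x)%:E).
Proof.
move=> mA; apply/measurable_EFinP/measurable_funM => //.
apply: measurable_funM => //.
by apply: (measurableT_comp _ mpsi); exact: measurable_indic.
Qed.

(** A simple function is the finite sum of its values times the indicators of its level sets, so
    linearity reduces the claim to indicators. *)
Let nnsfun_density (s : {nnsfun Y >-> R}) :
  \int[nu]_y (s y)%:E = \int[mu]_x ((s (psi x))%:E * (w x)%:E).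
Proof.
have ms r : measurable (s @^-1` [set r]).
  by rewrite -[_ @^-1` _]setTI; exact: measurable_funP.
transitivity (\int[mu]_x \sum_(r \in range s)
    ((r * \1_(s @^-1` [set r]) (psi x))%:E * (w x)%:E)); last first.
  apply: eq_integral => x _; rewrite [in RHS]fimfunE -fsumEFin//.
  rewrite ge0_mule_fsuml// => r.
  by rewrite EFinM; exact: nnfun_muleindic_ge0.
rewrite ge0_integral_fsum//; last 2 first.
- by move=> r; exact: measurable_indic_density.
- move=> r x _; apply: mule_ge0; last by rewrite lee_fin.
  by rewrite EFinM; exact: nnfun_muleindic_ge0.
rewrite integralT_nnsfun sintegralE; apply: eq_fsbigr => r _.
(* A negative [r] is not a value of [s]: its level set is empty and both terms vanish. *)
have [r0|r0] := leP 0%R r; last first.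
  rewrite preimage_nnfun0// measure0 mule0.
  by under eq_integral do rewrite indicE in_set0 mulr0 mul0e; rewrite integral0.
under eq_integral do rewrite EFinM -muleA.
rewrite ge0_integralZl_EFin//; first by rewrite integral_indic_density.
- by move=> x _; rewrite mule_ge0// lee_fin.
- have := measurable_indic_density 1 _ (ms r).
  by under eq_fun do rewrite mul1r.
Qed.

(** Simple functions increasing to [g] satisfy the formula, and monotone convergence passes to the
    limit on both sides. *)
Lemma ge0_integral_density_substitution (g : Y -> \bar R) :
  measurable_fun setT g -> (forall y, 0 <= g y) ->
  \int[nu]_y g y = \int[mu]_x (g (psi x) * (w x)%:E).
Proof.
move=> mg g0; pose s := nnsfun_approx measurableT mg.
have sg y : (s n y)%:E @[n --> \oo] --> g y.
  by apply: cvg_nnsfun_approx.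
transitivity (limn (fun n => \int[nu]_y (s n y)%:E)).
  rewrite -monotone_convergence//.
  - by apply: eq_integral => y _; apply/esym/cvg_lim => //; exact: sg.
  - by move=> n; exact/measurable_EFinP/measurable_funP.
  - by move=> n y _; rewrite lee_fin.
  - by move=> y _ m n mn; rewrite lee_fin; exact/lefP/nd_nnsfun_approx.
under eq_fun do rewrite nnsfun_density.
rewrite -monotone_convergence//.
- apply: eq_integral => x _; apply/cvg_lim => //.
  by apply: cvgeZr => //; exact: sg.
- move=> n; apply/measurable_EFinP/measurable_funM => //.
  by apply: (measurableT_comp _ mpsi); exact: measurable_funP.
- by move=> n x _; rewrite mule_ge0 ?lee_fin.
- move=> x _ m n mn; apply: lee_wpmul2r; rewrite lee_fin//.
  exact/lefP/nd_nnsfun_approx.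
Qed.

End density_substitution.

(** * Affine and logarithmic substitutions for Lebesgue measure *)

Section lebesgue_substitution.
Local Open Scope ereal_scope.
Context (R : realType).
Local Notation mu := (@lebesgue_measure R).

(** The set function [nu] below is a measure that gives half-open intervals their length. By
    uniqueness it is Lebesgue measure, so the density formula applies. *)
Lemma ge0_lebesgue_substitution (psi w : R -> R) (g : R -> \bar R) :
    measurable_fun setT psi -> measurable_fun setT w ->
    (forall u, (0 <= w u)%R) ->
    (forall c d, (c < d)%R ->
      \int[mu]_(u in psi @^-1` `]c, d]) (w u)%:E = (d - c)%:E) ->
    measurable_fun setT g -> (forall v, 0 <= g v) ->
  \int[mu]_v g v = \int[mu]_u (g (psi u) * (w u)%:E).
Proof.
move=> mpsi mw w0 wcd mg g0.
apply: ge0_integral_density_substitution => // A mA.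
pose nu (B : set (measurableTypeR R)) := \int[mu]_(u in psi @^-1` B) (w u)%:E.
have nu0 : nu set0 = 0 by rewrite /nu preimage_set0 integral_set0.
have nu_ge0 B : 0 <= nu B by apply: integral_ge0 => u _; rewrite lee_fin.
have nu_sigma_additive : semi_sigma_additive nu.
  move=> F mF tF mUF; rewrite /nu preimage_bigcup.
  have mpsiF n : measurable (psi @^-1` F n).
    by rewrite -[_ @^-1` _]setTI; apply: mpsi => //; exact: mF.
  apply: semi_sigma_additive_nng_induced => //.
  - exact/measurable_EFinP.
  - apply/trivIsetP => i j _ _ ij; rewrite -preimage_setI.
    by move/trivIsetP : tF => -> //; rewrite preimage_set0.
  - exact: bigcupT_measurable.
pose nu_mixin := isMeasure.Build _ _ _ nu nu0 nu_ge0 nu_sigma_additive.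
pose nu_measure : {measure set _ -> \bar R} := HB.pack nu nu_mixin.
apply: (@lebesgue_measure_unique R nu_measure) => // _ [[c d]] _ <- /=.
rewrite lebesgue_measure_itv/= lte_fin; case: ltP => cd.
  by rewrite /nu wcd // EFinB.
by rewrite /nu set_itv_ge ?preimage_set0 ?integral_set0// bnd_simp -leNgt.
Qed.

Lemma ge0_lebesgue_substitution_affine (a b : R) (g : R -> \bar R) :
    a != 0%R -> measurable_fun setT g -> (forall v, 0 <= g v) ->
  \int[mu]_v g v = `|a|%:E * \int[mu]_t g (a * t + b)%R.
Proof.
move=> a0 mg g0.
have maff : measurable_fun setT (fun t : R => a * t + b)%R.
  by apply: measurable_funD => //; exact: measurable_funM.
rewrite (@ge0_lebesgue_substitution (fun t => a * t + b)%R (cst `|a|%R) g)//.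
  rewrite -ge0_integralZl_EFin//.
  - by apply: eq_integral => t _; rewrite muleC.
  - exact: measurableT_comp.
move=> c d cd.
have [a_gt0|a_le0] := ltP 0%R a.
  have -> : (fun t => a * t + b)%R @^-1` `]c, d] =
      `]((c - b) / a)%R, ((d - b) / a)%R]%classic.
    apply/seteqP; split => t /=; rewrite !in_itv/= ltr_pdivrMr// ler_pdivlMr//;
      by rewrite ltrBlDr lerBrDr [(t * a)%R]mulrC.
  rewrite (eq_integral (cst `|a|%:E))// integral_cst//=.
  rewrite lebesgue_measure_itv/= lte_fin ltr_pM2r ?invr_gt0//.
  rewrite ltrD2r cd gtr0_norm// -EFinB -EFinM; congr _%:E; field.
  by rewrite gt_eqF.
have a_lt0 : (a < 0)%R by rewrite lt_neqAle a0.
(* A negative slope reverses the interval, so the closed end is now on the left. *)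
have -> : (fun t => a * t + b)%R @^-1` `]c, d] =
    `[((d - b) / a)%R, ((c - b) / a)%R[%classic.
  apply/seteqP; split => t /=; rewrite !in_itv/= ltr_ndivlMr// ler_ndivrMr//;
    by rewrite ltrBlDr lerBrDr [(t * a)%R]mulrC andbC.
rewrite (eq_integral (cst `|a|%:E))// integral_cst//=.
rewrite lebesgue_measure_itv/= lte_fin ltr_nM2r ?invr_lt0//.
rewrite ltrD2r cd ltr0_norm// -EFinB -EFinM; congr _%:E; field.
by rewrite lt_eqF.
Qed.

Lemma integral_inv (p q : R) : (0 < p)%R -> (p < q)%R ->
  \int[mu]_(u in `[p, q]) (u^-1)%:E = (ln q - ln p)%:E.
Proof.
move=> p0 pq.
have Dln (u : R) : (0 < u)%R -> is_derive u 1%R (@ln R) (u^-1)%R.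
  exact: is_derive1_ln.
have q0 := lt_trans p0 pq.
rewrite (@continuous_FTC2 _ _ (@ln R))// ?EFinB//.
- apply: continuous_in_subspaceT => u /[!inE]/= /[!in_itv]/= /andP[pu _].
  by apply: continuousV; [rewrite gt_eqF// (lt_le_trans p0)|exact: cvg_id].
- split.
  + move=> u /[!in_itv]/= /andP[pu _].
    by have [] := Dln u (lt_trans p0 pu).
  + by apply: cvg_at_right_filter; exact: continuous_ln.
  + by apply: cvg_at_left_filter; exact: continuous_ln.
- move=> u /[!in_itv]/= /andP[pu _]; rewrite derive1E.
  by have [] := Dln u (lt_trans p0 pu).
Qed.

Lemma ge0_lebesgue_substitution_ln (g : R -> \bar R) :
    measurable_fun setT g -> (forall v, 0 <= g v) ->
  \int[mu]_v g v = \int[mu]_(u in `]0%R, +oo[) (g (ln u) * (u^-1)%:E).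
Proof.
move=> mg g0.
(* This is [u^-1] cut off to the positive half-line, in a form whose measurability follows by
   composition and product. *)
pose w (u : R) := (expR (- ln u) * \1_`]0%R, +oo[ u)%R.
have wE u : w u = if (0 < u)%R then u^-1%R else 0%R.
  rewrite /w indicE mem_setE in_itv/= andbT; case: ifPn => u0.
    by rewrite mulr1 expRN lnK.
  by rewrite mulr0.
have mw : measurable_fun setT w.
  apply: measurable_funM; last exact: measurable_indic.
  by apply: measurableT_comp => //; apply: measurableT_comp.
rewrite (@ge0_lebesgue_substitution (@ln R) w g)//.
- rewrite [RHS]integral_mkcond; apply: eq_integral => u _.
  by rewrite wE /patch mem_setE in_itv/= andbT; case: ifPn; rewrite ?mule0.
- by move=> u; rewrite wE; case: ifPn => // /ltW; rewrite invr_ge0.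
move=> c d cd.
(* Where [w] is nonzero, [ln u] lies in []c, d]] exactly when [u] lies between [expR c] and
   [expR d]; for [u <= 0] both integrands vanish. *)
transitivity (\int[mu]_(u in `]expR c, expR d]) (u^-1)%:E).
  rewrite integral_mkcond [RHS]integral_mkcond; apply: eq_integral => u _.
  rewrite /patch wE; have [u0|u0] := ltP 0%R u; last first.
    rewrite [in RHS]mem_setE in_itv/= ltNge (le_trans u0) ?expR_ge0//=.
    by case: ifP.
  congr (if _ then _ else _); rewrite [in RHS]mem_setE in_itv/=.
  rewrite -[u in RHS](lnK u0) ltr_expR ler_expR.
  by apply/idP/idP; rewrite inE.
have mV : measurable_fun `]expR c, expR d] (fun u : R => u^-1%R).
  apply: (eq_measurable_fun w); last exact: measurable_funTS.
  move=> u; rewrite inE/= in_itv/= => /andP[cu _].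
  by rewrite wE (lt_trans (expR_gt0 c) cu).
rewrite integral_itv_obnd_cbnd; last exact/measurable_EFinP.
by rewrite integral_inv ?expR_gt0 ?ltr_expR// !expRK.
Qed.

End lebesgue_substitution.

(** * The two integral means of [f] as integrals over the unit interval *)

Section means.
Local Open Scope ereal_scope.
Context (R : realType).
Local Notation mu := (@lebesgue_measure R).
Implicit Types (f : R -> R) (x y p q : R).

Import HBNNSimple.

(** For [y < x] the sign of the integral cancels that of [y - x], so the mean is symmetric in its
    endpoints. *)
Lemma divr_oriented_integral f x y : x != y ->
  ((y - x)^-1)%:E * oriented_integral x y f =
  (`|x - y|^-1)%:E *
    \int[mu]_(u in `[Num.min x y, Num.max x y]) (f u)%:E.
Proof.
rewrite /oriented_integral; case: ltgtP => // xy _.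
  by rewrite distrC gtr0_norm ?subr_gt0.
by rewrite gtr0_norm ?subr_gt0// muleN -mulNe -EFinN -invrN opprB.
Qed.

(** The substitution is applied to a simple function [s] below [f], which is measurable. Its
    composite with the affine map stays below that of [f]. *)
Lemma integral_le_affine_mean f x y : x != y ->
    (forall u, u \in `[Num.min x y, Num.max x y] -> (0 <= f u)%R) ->
  \int[mu]_(u in `[Num.min x y, Num.max x y]) (f u)%:E <=
  `|x - y|%:E * \int[mu]_(t in `[0%R, 1%R]) (f (t * x + (1 - t) * y)%R)%:E.
Proof.
move=> xy f0; set I := `[_, _]; have xy0 : (x - y != 0)%R by rewrite subr_eq0.
(* An equivalence is needed: restricting [f] to [I] must become restricting the composite to the
   unit interval. *)
have inI t : ((x - y) * t + y)%R \in I = (t \in `[0%R, 1%R]).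
  rewrite !in_itv/= ge_min le_max; case: (ltgtP x y) xy => // xy _; last first.
    by apply/idP/idP => /andP[? ?]; apply/andP; split; nra.
  by apply/idP/idP => /andP[? ?]; apply/andP; split; nra.
apply: ge0_integral_le_nnsfun => [u uI|s sf]; first by rewrite lee_fin f0.
rewrite (@ge0_lebesgue_substitution_affine _ (x - y)%R y)//; last 2 first.
- by apply/measurable_EFinP; exact: (measurable_funPT s).
- by move=> v; rewrite lee_fin.
rewrite lee_pmul2l ?lte_fin ?normr_gt0// [leRHS]integral_mkcond.
apply: ge0_le_lower_integral => t _; first by rewrite lee_fin.
rewrite (le_trans (sf _))// /patch !mem_setE inI; case: ifP => //= _.
by rewrite lee_fin (_ : _ + y = t * x + (1 - t) * y)%R//; ring.
Qed.

Lemma affine_mean_integral_le f x y : x != y ->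
    (forall u, u \in `[Num.min x y, Num.max x y] -> (0 <= f u)%R) ->
  ((y - x)^-1)%:E * oriented_integral x y f <=
  \int[mu]_(t in `[0%R, 1%R]) (f (t * x + (1 - t) * y)%R)%:E.
Proof.
move=> xy f0; rewrite divr_oriented_integral// lee_pdivrMl.
  exact: integral_le_affine_mean.
by rewrite normr_gt0 subr_eq0.
Qed.

(** With [u = expR v] and [du = expR v dv], a simple [s] with [s u <= f u / u] yields
    [s (expR v) * expR v <= f (expR v)]. *)
Lemma integral_le_expR_substitution f p q : (0 < p)%R -> (p <= q)%R ->
    (forall u, u \in `[p, q] -> (0 <= f u)%R) ->
  \int[mu]_(u in `[p, q]) (f u / u)%:E <=
  \int[mu]_(v in `[ln p, ln q]) (f (expR v))%:E.
Proof.
move=> p0 pq f0; have q0 := lt_le_trans p0 pq.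
have pos u : u \in `[p, q] -> (0 < u)%R.
  by rewrite in_itv/= => /andP[pu _]; exact: lt_le_trans pu.
apply: ge0_integral_le_nnsfun => [u uI|s sf].
  by rewrite lee_fin divr_ge0 ?f0// ltW// pos.
pose k v := (s (expR v) * expR v)%:E.
have -> : \int[mu]_u (s u)%:E = \int[mu]_v k v.
  rewrite [RHS]ge0_lebesgue_substitution_ln//; last 2 first.
  - apply/measurable_EFinP; apply: measurable_funM => //.
    by apply: measurableT_comp; first exact: (measurable_funPT s).
  - by move=> v; rewrite lee_fin mulr_ge0// expR_ge0.
  rewrite [RHS]integral_mkcond; apply: eq_integral => u _.
  rewrite /patch mem_setE in_itv/= andbT; case: ifPn => u0.
    by rewrite /k lnK// -EFinM mulfK// gt_eqF.
  (* At [u <= 0], outside [[p, q]], the nonnegative [s] is squeezed to 0 by the restriction of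
     [f u / u]. *)
  apply/eqP; rewrite eq_le; apply/andP; split; last by rewrite lee_fin.
  rewrite (le_trans (sf u))// /patch mem_setE.
  by case: ifPn => // /pos; rewrite (negbTE u0).
rewrite [leRHS]integral_mkcond; apply: ge0_le_lower_integral => v _.
  by rewrite lee_fin mulr_ge0// expR_ge0.
move: (sf (expR v)); rewrite /patch !mem_setE !in_itv/=.
rewrite -(@ler_expR _ (ln p)) -(@ler_expR _ v) !lnK//.
case: ifP => _; rewrite lee_fin => sv.
  by rewrite lee_fin -ler_pdivlMr// expR_gt0.
by rewrite lee_fin mulr_le0_ge0// expR_ge0.
Qed.

(** Since [x^t y^(1-t)] is the exponential of [t ln x + (1-t) ln y], the right side is the affine
    mean of [f \o expR] between [ln x] and [ln y]. *)
Lemma geometric_mean_integral_le f x y : (0 < x)%R -> (0 < y)%R -> x != y ->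
    (forall u, u \in `[Num.min x y, Num.max x y] -> (0 <= f u)%R) ->
  ((ln y - ln x)^-1)%:E * oriented_integral x y (fun u => (f u / u)%R) <=
  \int[mu]_(t in `[0%R, 1%R]) (f (x `^ t * y `^ (1 - t))%R)%:E.
Proof.
move=> x0 y0 xy f0.
have lnxy : ln x != ln y by apply: contra_neq xy; exact: ln_inj.
have expf0 v : v \in `[Num.min (ln x) (ln y), Num.max (ln x) (ln y)] ->
    (0 <= f (expR v))%R.
  move=> vI; apply: f0; move: vI; rewrite !in_itv/= !ge_min !le_max.
  by rewrite -!(ler_expR _ v) -!(ler_expR v) !lnK.
have meanE : \int[mu]_(t in `[0%R, 1%R]) (f (x `^ t * y `^ (1 - t))%R)%:E =
    \int[mu]_(t in `[0%R, 1%R]) ((f \o expR) (t * ln x + (1 - t) * ln y)%R)%:E.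
  apply: eq_integral => t _.
  by rewrite /= expRD ![(_ * ln _)%R]mulrC !expRM !lnK.
rewrite meanE.
apply: le_trans (affine_mean_integral_le (f \o expR) _ _ lnxy expf0).
have f0' u p q : (p = x /\ q = y) \/ (p = y /\ q = x) -> (p < q)%R ->
    u \in `[p, q] -> (0 <= f u)%R.
  move=> + pq uI; have pqI : u \in `[Num.min p q, Num.max p q].
    by rewrite min_l ?max_r ?ltW.
  by case=> -[pE qE]; apply: f0; rewrite -?pE -?qE// minC maxC.
rewrite /oriented_integral ler_ln//; case: (ltgtP x y) xy => // xy _.
  apply: lee_wpmul2l; first by rewrite lee_fin invr_ge0 subr_ge0 ler_ln// ltW.
  by apply: integral_le_expR_substitution => [//||u]; first exact: ltW;
    apply: f0' => //; left.
(* For [y < x] the minus sign goes into the prefactor, which becomes the nonnegative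
   [(ln x - ln y)^-1]. *)
rewrite !muleN -!mulNe -EFinN -invrN opprB.
apply: lee_wpmul2l; first by rewrite lee_fin invr_ge0 subr_ge0 ler_ln// ltW.
by apply: integral_le_expR_substitution => [//||u]; first exact: ltW;
  apply: f0' => //; right.
Qed.

End means.

(** * Integration of the convexity inequality *)

Theorem theorem7 (R : realType) (a b : R) (a_gt0 : 0 < a) (leab : a <= b)
    (J : set R) (J01 : [set` `[0, 1]] `<=` J)
    (h : R -> R) (h_ge0 : forall t : R, J t -> 0 <= h t)
    (f : R -> R) (f_gt0 : forall x : R, x \in `[a, b] -> 0 < f x)
    (f_hmc : h_multi_convex [set` `[a, b]] h f)
    (x y : R) (xI : x \in `[a, b]) (yI : y \in `[a, b]) (x_neq_y : x <> y) :
  ((2^-1)%:E *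
     (((ln y - ln x)^-1)%:E * oriented_integral x y (fun u : R => (f u / u)%R) +
      ((y - x)^-1)%:E * oriented_integral x y f)
   <= \int[lebesgue_measure]_(t in `[0%R, 1%R])
        (f x `^ h t * f y `^ h (1 - t))%:E)%E.
Proof.
have [ax xb] : a <= x /\ x <= b by move: xI; rewrite in_itv/= => /andP[].
have [ay yb] : a <= y /\ y <= b by move: yI; rewrite in_itv/= => /andP[].
have x0 := lt_le_trans a_gt0 ax; have y0 := lt_le_trans a_gt0 ay.
have xy : x != y by apply/eqP.
have fI u : u \in `[Num.min x y, Num.max x y] -> 0 < f u.
  rewrite in_itv/= ge_min le_max => /andP[xyu uxy]; apply: f_gt0.
  by rewrite in_itv/=; apply/andP; split;
    [case/orP: xyu|case/orP: uxy]; lra.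
have affI t : t \in `[0, 1] -> t * x + (1 - t) * y \in `[a, b].
  by rewrite !in_itv/= => /andP[? ?]; apply/andP; split; nra.
have geoI t : t \in `[0, 1] -> x `^ t * y `^ (1 - t) \in `[a, b].
  rewrite !in_itv/= => /andP[t0 t1].
  have b0 := lt_le_trans a_gt0 leab.
  have xy0 : 0 < x `^ t * y `^ (1 - t) by rewrite mulr_gt0 ?powR_gt0.
  (* After taking logarithms, the geometric mean is a convex combination of [ln x] and [ln y], both
     between [ln a] and [ln b]. *)
  rewrite -(ler_ln a_gt0 xy0) -(ler_ln xy0 b0) lnM ?posrE ?powR_gt0//.
  rewrite !ln_powR.
  have : ln a <= ln x by rewrite ler_ln.
  have : ln a <= ln y by rewrite ler_ln.
  have : ln x <= ln b by rewrite ler_ln.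
  have : ln y <= ln b by rewrite ler_ln.
  by move=> ? ? ? ?; apply/andP; split; nra.
have half0 : (0 < 2^-1 :> R) by rewrite invr_gt0.
pose F (t : R) := (f (x `^ t * y `^ (1 - t)))%:E.
pose G (t : R) := (f (t * x + (1 - t) * y))%:E.
have F0 t : [set` `[0, 1]] t -> (0 <= F t)%E.
  by move=> tI; rewrite lee_fin ltW// f_gt0// geoI.
have G0 t : [set` `[0, 1]] t -> (0 <= G t)%E.
  by move=> tI; rewrite lee_fin ltW// f_gt0// affI.
have fI0 u : u \in `[Num.min x y, Num.max x y] -> 0 <= f u by move/fI/ltW.
(* The factor one half becomes a factor 2 on the right, so superadditivity on the left and scaling
   on the right are used in the directions proved above. *)
rewrite lee_pdivrMl//.
apply: le_trans (leeD (geometric_mean_integral_le _ _ _ _ x0 y0 xy fI0)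
                      (affine_mean_integral_le _ _ _ _ xy fI0)) _.
apply: (le_trans (le_lower_integralD _ _ _ lebesgue_measure _ F G F0 G0)).
apply: le_trans (lower_integralZl_le _ _ _ _ _ _ _ _ _); last 2 first.
- by [].
- by move=> t _; rewrite lee_fin mulr_ge0// powR_ge0.
apply: ge0_le_lower_integral => t tI; first by rewrite adde_ge0 ?F0 ?G0.
have tI' : 0 <= t <= 1 by move: tI; rewrite /= in_itv.
have half01 : 0 <= (2^-1 : R) <= 1 by apply/andP; split; lra.
(* Doubling this instance bounds [F t + G t] pointwise. *)
have := f_hmc x y t 2^-1 xI yI tI' half01.
by rewrite -EFinD -EFinM lee_fin; lra.
Qed.
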